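(* There exists a planar graph that is not $(3,5)$-choosable (in the sense of union separation).
   Context: Graphs are finite and simple. For integers $t \geq k$, a $(k,t)$-list assignment of a graph $G$ (union separation) is a function $L$ assigning to each vertex $v$ a set $L(v)$ of colors such that $|L(v)| \geq k$ for all vertices $v$ and $|L(u)\cup L(v)| \geq t$ for all edges $uv$. An $L$-coloring is an assignment $c$ of colors to the vertices with $c(v) \in L(v)$ for all vertices $v$ and $c(u)\neq c(v)$ for all adjacent $u,v$. A graph is $(k,t)$-choosable if it has an $L$-coloring for every $(k,t)$-list assignment $L$. *)

(* Defs.v *)
From HB Require Import structures.
From mathcomp Require Import all_boot all_order all_algebra.
From mathcomp Require Import all_classical all_reals all_analysis.
Import Order.TTheory GRing.Theory Num.Theory.
Import numFieldNormedType.Exports.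

Set Implicit Arguments.
Unset Strict Implicit.
Unset Printing Implicit Defensive.

Local Open Scope classical_set_scope.
Local Open Scope ring_scope.
Local Open Scope card_scope.

Record sgraph := SGraph {
  vertex :> finType;
  adj : rel vertex;
  adj_sym : symmetric adj;
  adj_irrefl : irreflexive adj
}.

Definition arc_between (R : realType) (p q : R * R) (A : set (R * R)) : Prop :=
  exists g : R -> R * R,
    [/\ {within `[0, 1], continuous g},
        {in `[0, 1] &, injective g},
        g 0 = p, g 1 = q & A = g @` `[0, 1]].

(* The edge joining u and v is the unordered pair [set u; v], so that E assigns
   one subset of the plane to it, whichever way it is oriented.  The values of
   E on sets that are not edges are irrelevant. *)
Definition is_plane_drawing (R : realType) (G : sgraph)
    (pos : G -> R * R) (E : {set G} -> set (R * R)) : Prop :=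
  let inner u v := E [set u; v]%SET `\` [set pos u; pos v] in
  [/\ injective pos,
      forall u v, adj u v -> arc_between (pos u) (pos v) (E [set u; v]%SET),
      forall u v w, adj u v -> ~ inner u v (pos w)
    & forall u v x y, adj u v -> adj x y ->
        [set u; v]%SET != [set x; y]%SET ->
        inner u v `&` E [set x; y]%SET = set0].

Definition planar (R : realType) (G : sgraph) : Prop :=
  exists (pos : G -> R * R) (E : {set G} -> set (R * R)),
    is_plane_drawing pos E.

(* Lists may be infinite; `I_n is the set of naturals below n, so
   `I_n #<= A says that A has at least n elements. *)
Definition list_assignment (k t : nat) (G : sgraph) (C : Type)
    (L : G -> set C) : Prop :=
  (forall v, `I_k #<= L v) /\
  (forall u v, adj u v -> `I_t #<= L u `|` L v).

Definition list_coloring (G : sgraph) (C : Type) (L : G -> set C)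
    (c : G -> C) : Prop :=
  (forall v, L v (c v)) /\ (forall u v, adj u v -> c u <> c v).

Definition choosable (k t : nat) (G : sgraph) : Prop :=
  forall (C : Type) (L : G -> set C), list_assignment k t L ->
    exists c : G -> C, list_coloring L c.

(* Main.v *)
(* Both poles of a fan over a long path ("spine") are joined to every spine
   vertex, and an apex is stacked into each triangle formed by a pole and two
   consecutive spine vertices.  The poles get the disjoint lists {0, 1, 2} and
   {3, 4, 5}; each of the nine pairs (x, y) of pole colours has its own gadget
   of three consecutive spine vertices, with lists {x, y, 8, 9}, {x, y, 6, 7},
   {x, y, 8, 9}.  If the poles are coloured x and y, the middle one takes 6 or
   7.  The apices between it and one of its neighbours then have lists such as
   {x, 7, 8} and {y, 7, 9}, which forces them to take 8 and 9, so that this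
   neighbour cannot be coloured.

   The graph is drawn with straight edges; two edges do not cross because some
   line, given explicitly for each pair of edge types, separates them. *)

Require Import Defs.
From HB Require Import structures.
From mathcomp Require Import all_boot all_order all_algebra.
From mathcomp Require Import all_classical all_reals all_analysis.
From mathcomp Require Import ring lra zify.
Import Order.TTheory GRing.Theory Num.Theory.
Import numFieldNormedType.Exports.

Set Implicit Arguments.
Unset Strict Implicit.
Unset Printing Implicit Defensive.

Local Open Scope classical_set_scope.
Local Open Scope ring_scope.
Local Open Scope card_scope.

(** * Straight-line plane drawings *)

Section StraightLineDrawings.
Variable R : realType.
Implicit Types p q r s z : R * R.

Definition line_path p q (t : R) : R * R :=
  (p.1 + t * (q.1 - p.1), p.2 + t * (q.2 - p.2)).

Definition segment p q : set (R * R) := line_path p q @` `[0, 1].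

Lemma segmentC p q : segment p q = segment q p.
Proof.
suff sub p' q' : segment p' q' `<=` segment q' p' by apply/seteqP; split.
move=> _ [t /= t01 <-]; exists (1 - t).
  by move: t01; rewrite /= !in_itv /=; lra.
by rewrite /line_path; congr pair; ring.
Qed.

Lemma line_path0 p q : line_path p q 0 = p.
Proof. by rewrite /line_path !mul0r !addr0 -surjective_pairing. Qed.

Lemma line_path1 p q : line_path p q 1 = q.
Proof.
by rewrite /line_path !mul1r (addrC p.1) (addrC p.2) !subrK -surjective_pairing.
Qed.

Lemma segment_id p : segment p p `<=` [set p].
Proof.
move=> _ [t _ <-].
by rewrite /line_path !subrr !mulr0 !addr0 -surjective_pairing.
Qed.

Lemma segment_left p q : segment p q p.
Proof.
exists 0; first by rewrite /= in_itv /= lexx ler01.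
exact: line_path0.
Qed.

Lemma continuous_line_path p q : continuous (line_path p q).
Proof.
have affine (x y : R) : continuous (fun t : R => x + t * (y - x)).
  move=> t; apply: cvgD; first exact: cvg_cst.
  by apply: cvgM; [exact: cvg_id | exact: cvg_cst].
by move=> t; exact: (cvg_pair (affine p.1 q.1 t) (affine p.2 q.2 t)).
Qed.

Lemma line_path_inj p q : p != q -> injective (line_path p q).
Proof.
case: p q => [p1 p2] [q1 q2] pq t u [/addrI e1 /addrI e2].
have [d1|d1] := eqVneq (q1 - p1) 0; last exact: (mulIf d1).
have [d2|d2] := eqVneq (q2 - p2) 0; last exact: (mulIf d2).
by move: pq; rewrite -(subr0_eq d1) -(subr0_eq d2) eqxx.
Qed.

Lemma arc_between_segment p q : p != q -> arc_between p q (segment p q).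
Proof.
move=> pq; exists (line_path p q); split => //.
- exact/continuous_subspaceT/continuous_line_path.
- by move=> t u _ _; apply: line_path_inj.
- exact: line_path0.
- exact: line_path1.
Qed.

(* An affine form that is nonnegative and not identically zero on the segment
   pq is positive inside pq; being nonpositive on rs, it keeps the interior of
   pq away from rs, although the two segments may share an endpoint. *)
Definition line_separated p q r s : Prop := exists a b c : R,
  let f z := a * z.1 + b * z.2 + c in
  [/\ 0 <= f p, 0 <= f q, 0 < f p + f q, f r <= 0 & f s <= 0].

Lemma line_separated_symL p q r s :
  line_separated p q r s -> line_separated q p r s.
Proof.
move=> [a [b [c [fp fq fpq fr fs]]]]; exists a, b, c; split=> //.
by rewrite addrC.
Qed.

Lemma line_separated_symR p q r s :
  line_separated p q r s -> line_separated p q s r.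
Proof. by move=> [a [b [c [fp fq fpq fr fs]]]]; exists a, b, c; split. Qed.

Lemma line_separated_inner p q r s : line_separated p q r s ->
  (segment p q `\` [set p; q]) `&` segment r s = set0.
Proof.
move=> [a [b [c sep]]]; set f := fun z => a * z.1 + b * z.2 + c.
have [fp fq fpq fr fs] :
  [/\ 0 <= f p, 0 <= f q, 0 < f p + f q, f r <= 0 & f s <= 0] by [].
rewrite -subset0 => z [[[t t01 tz] zpq] [u u01 uz]].
have fline p' q' v : f (line_path p' q' v) = (1 - v) * f p' + v * f q'.
  by rewrite /f /line_path /=; ring.
have tN0 : t != 0.
  apply/eqP => t0; apply: zpq; left.
  by rewrite -tz t0 line_path0.
have tN1 : t != 1.
  apply/eqP => t1; apply: zpq; right.
  by rewrite -tz t1 line_path1.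
move: t01 u01; rewrite /= !in_itv /= => /andP[t0 t1] /andP[u0 u1].
have {}t0 : 0 < t by rewrite lt0r tN0.
have {}t1 : t < 1 by rewrite lt_neqAle tN1.
have fz_gt0 : 0 < f z.
  rewrite -tz fline; have [fp0|fp0] := ltP 0 (f p).
    by apply: ltr_pwDl; [apply: mulr_gt0 | apply: mulr_ge0] => //; lra.
  by apply: ltr_wpDl; [apply: mulr_ge0 | apply: mulr_gt0] => //; lra.
have fz_le0 : f z <= 0.
  rewrite -uz fline -oppr_ge0 opprD -!mulrN.
  by apply: addr_ge0; apply: mulr_ge0; rewrite ?oppr_ge0 //; lra.
by move: fz_gt0; rewrite ltNge fz_le0.
Qed.

(** An unordered pair does not say which endpoint comes first. Taking all segments between members
    of [S] avoids a choice; the degenerate ones add only endpoints. *)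
Definition drawn_set (G : sgraph) (pos : G -> R * R) (S : {set G}) :
    set (R * R) :=
  [set z | exists u v, [/\ u \in S, v \in S & segment (pos u) (pos v) z]].

Lemma drawn_set2 (G : sgraph) (pos : G -> R * R) u v :
  drawn_set pos [set u; v]%SET = segment (pos u) (pos v).
Proof.
apply/seteqP; split=> [z [x [y [+ + xyz]]]|z uvz]; last first.
  by exists u, v; rewrite !inE !eqxx orbT.
have left_sub : segment (pos u) (pos u) `<=` segment (pos u) (pos v).
  by move=> ? /segment_id ->; apply: segment_left.
have right_sub : segment (pos v) (pos v) `<=` segment (pos u) (pos v).
  by move=> ? /segment_id ->; rewrite segmentC; apply: segment_left.
rewrite !inE => /orP[]/eqP xE /orP[]/eqP yE; rewrite xE yE in xyz.
- exact: left_sub.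
- by [].
- by rewrite segmentC.
- exact: right_sub.
Qed.

(** No vertex [w] lies inside an edge [uv]: by the second hypothesis [w] is an end of some edge,
    which either is [uv] itself or is separated from the interior of [uv]. *)
Lemma planar_straight (G : sgraph) (pos : G -> R * R) :
  injective pos ->
  (forall u : G, exists v, adj u v) ->
  (forall u v x y : G, adj u v -> adj x y ->
     [set u; v]%SET != [set x; y]%SET ->
     line_separated (pos u) (pos v) (pos x) (pos y)) ->
  planar R G.
Proof.
move=> pos_inj nbr sep; exists pos, (drawn_set pos).
have adjN (u v : G) : adj u v -> u != v.
  by move=> uv; apply/eqP => E; rewrite E adj_irrefl in uv.
split=> //= [u v uv | u v w uv | u v x y uv xy ne]; rewrite !drawn_set2.
- by apply: arc_between_segment; rewrite (inj_eq pos_inj) adjN.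
- have [x wx] := nbr w; rewrite -(drawn_set2 pos u v) => -[wuv wNuv].
  have ne : [set u; v]%SET != [set w; x]%SET.
    apply/eqP => E; have : w \in [set u; v]%SET by rewrite E !inE eqxx.
    by rewrite !inE => /orP[] /eqP wE; apply: wNuv; rewrite wE; [left|right].
  have := line_separated_inner (sep _ _ _ _ uv wx ne).
  rewrite -subset0 -(drawn_set2 pos u v) => disj.
  by apply: (disj (pos w)); split=> //; apply: segment_left.
- exact/line_separated_inner/sep.
Qed.

End StraightLineDrawings.

(** * The stacked fan *)

Section StackedFan.
Variable n : nat.

Definition fan_vertex := (bool + 'I_n.+1 + bool * 'I_n)%type.

Definition pole (b : bool) : fan_vertex := inl (inl b).
Definition spine (k : 'I_n.+1) : fan_vertex := inl (inr k).
Definition apex (b : bool) (k : 'I_n) : fan_vertex := inr (b, k).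

(** Each edge appears in one orientation only, so a pair of edges falls into 25 cases, from the five
    kinds of [fan_arc_spec]. *)
Definition fan_arc (u v : fan_vertex) : bool :=
  match u, v with
  | inl (inl _), inl (inr _) => true
  | inl (inl b), inr (c, _) => b == c
  | inl (inr k), inl (inr l) => l == k.+1 :> nat
  | inl (inr l), inr (_, k) => (l == k :> nat) || (l == k.+1 :> nat)
  | _, _ => false
  end.

Definition fan_adj : rel fan_vertex := [rel u v | fan_arc u v || fan_arc v u].

Lemma fan_adj_sym : symmetric fan_adj.
Proof. by move=> u v; rewrite /fan_adj /= orbC. Qed.

Lemma fan_adj_irrefl : irreflexive fan_adj.
Proof. by move=> [[b|k]|[b k]] //; rewrite /fan_adj /= orbb ltn_eqF. Qed.

Definition fan : sgraph := SGraph fan_adj_sym fan_adj_irrefl.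

Variant fan_arc_spec : fan -> fan -> Prop :=
| ArcPoleSpine b k : fan_arc_spec (pole b) (spine k)
| ArcSpine (k l : 'I_n.+1) of l = k.+1 :> nat : fan_arc_spec (spine k) (spine l)
| ArcPoleApex b k : fan_arc_spec (pole b) (apex b k)
| ArcApexL b (k : 'I_n) (l : 'I_n.+1) of l = k :> nat :
    fan_arc_spec (spine l) (apex b k)
| ArcApexR b (k : 'I_n) (l : 'I_n.+1) of l = k.+1 :> nat :
    fan_arc_spec (spine l) (apex b k).

Lemma fan_arcP (u v : fan) : fan_arc u v -> fan_arc_spec u v.
Proof.
case: u v => [[b|k]|[b k]] [[c|l]|[c l]] //=.
- by constructor.
- by move=> /eqP <-; constructor.
- by move=> /eqP; constructor.
- by case/orP=> /eqP kl; [apply: ArcApexL | apply: ArcApexR].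
Qed.

(** * A plane drawing of the stacked fan *)

Variable R : realType.

Definition sgb (b : bool) : R := if b then 1 else -1.

(** An apex is the midpoint between its pole and the midpoint of its spine edge, hence inside their
    triangle; the factor 4 keeps coordinates integral. *)
Definition fan_pos (v : fan) : R * R :=
  match v with
  | inl (inl b) => (0, 2 * sgb b)
  | inl (inr k) => (4 * k%:R, 0)
  | inr (b, k) => (2 * k%:R + 1, sgb b)
  end.

(** The gap of 1 between distinct integers is carried over to [R], where linear arithmetic can use
    it. *)
Lemma natr_leVgt (k l : nat) :
  (k%:R <= l%:R :> R) \/ (l%:R + 1 <= k%:R :> R).
Proof.
by case: (leqP k l) => kl; [left | right; rewrite natr1]; rewrite ler_nat.
Qed.

Lemma natr_ltVgt (k l : nat) : k != l ->
  (k%:R + 1 <= l%:R :> R) \/ (l%:R + 1 <= k%:R :> R).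
Proof.
by rewrite neq_ltn => /orP[] kl; [left | right]; rewrite natr1 ler_nat.
Qed.

Lemma fan_pos_inj : injective fan_pos.
Proof.
have sgbI b c : sgb b = sgb c -> b = c.
  by case: b c => -[] //; rewrite /sgb => e; exfalso; lra.
have natI m (i j : 'I_m) : i%:R = j%:R :> R -> i = j.
  by move=> ij; apply/ord_inj/eqP; rewrite -(eqr_nat R) ij.
move=> [[b|k]|[b k]] [[c|l]|[c l]] //= [].
- by move=> e; rewrite (sgbI b c) //; lra.
- by case: b; rewrite /sgb => *; exfalso; lra.
- by case: b c => -[]; rewrite /sgb => *; exfalso; lra.
- by case: c; rewrite /sgb => *; exfalso; lra.
- by move=> e; rewrite (natI _ k l) //; lra.
- by case: c; rewrite /sgb => *; exfalso; lra.
- by case: b c => -[]; rewrite /sgb => *; exfalso; lra.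
- by case: b; rewrite /sgb => *; exfalso; lra.
- by move=> e /sgbI ->; rewrite (natI _ k l) //; lra.
Qed.

Lemma sgbN b c : c != b -> sgb c = - sgb b.
Proof. by case: b c => -[] // _; rewrite /sgb ?opprK. Qed.

(** Splitting on [b] turns heights and signs into numerals. Indices then occur linearly, since the
    coefficients of the first coordinate are always constants. *)
Ltac separate_by b coefx coefy coef0 :=
  exists coefx, coefy, coef0; split; destruct b; rewrite /sgb /=; lra.

Ltac separate_upright b := separate_by b (0 : R) (sgb b) (0 : R).

(* The lines [x = t * (2 - sgb b * y)] through pole b; spine vertex k lies on
   the line of parameter [2 * k], the apices over k on that of [2 * k + 1]. *)
Ltac right_of_ray b t := separate_by b (1 : R) (t * sgb b) (- 2 * t).
Ltac left_of_ray b t := separate_by b (- 1 : R) (- t * sgb b) (2 * t).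

(* The lines through an apex over l and through spine vertex l, resp. l + 1. *)
Ltac left_of_apexL b l :=
  separate_by b (- 1 : R) ((1 - 2 * l) * sgb b) (4 * l).
Ltac right_of_apexL b l :=
  separate_by b (1 : R) ((2 * l - 1) * sgb b) (- 4 * l).
Ltac right_of_apexR b l :=
  separate_by b (1 : R) ((2 * l + 3) * sgb b) (- 4 * (l + 1)).
Ltac left_of_apexR b l :=
  separate_by b (- 1 : R) (- (2 * l + 3) * sgb b) (4 * (l + 1)).

(** The spine line separates edges on opposite sides, and spine edges from all others that come
    first. On one side, each edge spans a range of rays from the pole, and a ray bordering two
    ranges usually separates them. The other pairs use the horizontal line through the apices or the
    line of the second edge, since the first edge may touch the separator but not lie in it. *)
Lemma fan_arc_separated (u v x y : fan) :
  fan_arc u v -> fan_arc x y -> [set u; v]%SET != [set x; y]%SET ->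
  line_separated (fan_pos u) (fan_pos v) (fan_pos x) (fan_pos y).
Proof.
move=> /fan_arcP[b k|k k' ek|b k|b k k' ek|b k k' ek];
move=> /fan_arcP[c l|l l' el|c l|c l l' el|c l l' el] ne /=;
rewrite ?ek ?el -?natr1.
- have [cb|/sgbN ->] := eqVneq c b; last by separate_upright b.
  have kl : k != l :> nat by apply: contra_neq ne => /ord_inj ->; rewrite cb.
  rewrite cb; case: (natr_ltVgt kl) => h.
    by left_of_ray b (2 * l%:R : R).
  by right_of_ray b (2 * l%:R : R).
- by separate_upright b.
- have [->|/sgbN ->] := eqVneq c b; last by separate_upright b.
  case: (natr_leVgt k l) => h.
    by left_of_ray b (2 * l%:R + 1 : R).
  by right_of_ray b (2 * l%:R + 1 : R).
- have [->|/sgbN ->] := eqVneq c b; last by separate_upright b.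
  case: (natr_leVgt k l) => h.
    by left_of_apexL b (l%:R : R).
  by right_of_ray b (2 * l%:R + 1 : R).
- have [->|/sgbN ->] := eqVneq c b; last by separate_upright b.
  case: (natr_leVgt k l) => h.
    by left_of_ray b (2 * l%:R + 1 : R).
  by right_of_apexR b (l%:R : R).
- case: (natr_leVgt l k) => h.
    by right_of_ray c (2 * l%:R : R).
  by left_of_ray c (2 * l%:R : R).
- have kl : k != l :> nat.
    apply: contra_neq ne => kl; congr [set _; _]%SET; congr spine.
      exact: ord_inj.
    by apply: ord_inj; rewrite ek el kl.
  case: (natr_ltVgt kl) => h.
    (* For two spine edges the rays of either pole serve; [true] is an arbitrary choice. *)
    by left_of_ray true (2 * l%:R : R).
  by right_of_ray true (2 * k%:R : R).
- by separate_by c (0 : R) (- sgb c) (1 : R).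
- case: (natr_leVgt l k) => h.
    by right_of_apexL c (l%:R : R).
  by left_of_ray c (2 * l%:R : R).
- case: (natr_leVgt k l) => h.
    by left_of_apexR c (l%:R : R).
  by right_of_ray c (2 * k%:R : R).
- have [->|/sgbN ->] := eqVneq c b; last by separate_upright b.
  case: (natr_leVgt l k) => h.
    by right_of_ray b (2 * l%:R : R).
  by left_of_ray b (2 * l%:R : R).
- by separate_upright b.
- have [cb|/sgbN ->] := eqVneq c b; last by separate_upright b.
  have kl : k != l :> nat by apply: contra_neq ne => /ord_inj ->; rewrite cb.
  rewrite cb; case: (natr_ltVgt kl) => h.
    by left_of_ray b (2 * l%:R + 1 : R).
  by right_of_ray b (2 * l%:R + 1 : R).
- have [->|/sgbN ->] := eqVneq c b; last by separate_upright b.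
  by separate_by b (0 : R) (sgb b) (- 1 : R).
- have [->|/sgbN ->] := eqVneq c b; last by separate_upright b.
  by separate_by b (0 : R) (sgb b) (- 1 : R).
- have [->|/sgbN ->] := eqVneq c b; last by separate_upright b.
  case: (natr_leVgt l k) => h.
    by right_of_ray b (2 * l%:R : R).
  by left_of_ray b (2 * l%:R : R).
- by separate_upright b.
- have [->|/sgbN ->] := eqVneq c b; last by separate_upright b.
  case: (natr_leVgt k l) => h.
    by left_of_ray b (2 * l%:R + 1 : R).
  by right_of_ray b (2 * l%:R + 1 : R).
- have [cb|/sgbN ->] := eqVneq c b; last by separate_upright b.
  have kl : k != l :> nat.
    apply: contra_neq ne => kl; rewrite cb; congr [set _; _]%SET.
      by congr spine; apply: ord_inj; rewrite ek el kl.
    by congr apex; apply: ord_inj.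
  rewrite cb; case: (natr_ltVgt kl) => h.
    by left_of_ray b (2 * l%:R : R).
  by right_of_ray b (2 * k%:R : R).
- have [->|/sgbN ->] := eqVneq c b; last by separate_upright b.
  case: (natr_leVgt k l) => h.
    by left_of_ray b (2 * l%:R + 1 : R).
  by right_of_ray b (2 * k%:R : R).
- have [->|/sgbN ->] := eqVneq c b; last by separate_upright b.
  case: (natr_leVgt l k) => h.
    by right_of_ray b (2 * l%:R : R).
  by left_of_ray b (2 * l%:R : R).
- by separate_upright b.
- have [->|/sgbN ->] := eqVneq c b; last by separate_upright b.
  case: (natr_leVgt l k) => h.
    by right_of_ray b (2 * l%:R + 1 : R).
  by left_of_ray b (2 * l%:R + 1 : R).
- have [->|/sgbN ->] := eqVneq c b; last by separate_upright b.
  case: (natr_leVgt l k) => h.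
    by right_of_ray b (2 * k%:R + 1 : R).
  by left_of_ray b (2 * l%:R : R).
- have [cb|/sgbN ->] := eqVneq c b; last by separate_upright b.
  have kl : k != l :> nat.
    apply: contra_neq ne => kl; rewrite cb; congr [set _; _]%SET.
      by congr spine; apply: ord_inj; rewrite ek el kl.
    by congr apex; apply: ord_inj.
  rewrite cb; case: (natr_ltVgt kl) => h.
    by left_of_ray b (2 * k%:R + 2 : R).
  by right_of_ray b (2 * k%:R + 1 : R).
Qed.

Lemma planar_fan : planar R fan.
Proof.
apply: (planar_straight fan_pos_inj) => [|u v x y].
  case=> [[b|k]|[b k]].
  - by exists (spine ord0).
  - by exists (pole true).
  - by exists (pole b); rewrite /adj /= /fan_adj /= eqxx.
have set2C (a b : fan) : [set a; b]%SET = [set b; a]%SET := finset.setUC _ _.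
rewrite /adj /= /fan_adj /= => /orP[]uv /orP[]xy ne.
- exact: fan_arc_separated.
- apply: line_separated_symR; apply: fan_arc_separated => //.
  by rewrite (set2C y).
- apply: line_separated_symL; apply: fan_arc_separated => //.
  by rewrite (set2C v).
- apply: line_separated_symL; apply: line_separated_symR.
  by apply: fan_arc_separated; rewrite // (set2C v) (set2C y).
Qed.

End StackedFan.

(** * The lists, their sizes and their unions *)

Lemma card_le_uniq (T : eqType) (s : seq T) (A : set T) :
  uniq s -> (forall x, x \in s -> A x) -> `I_(size s) #<= A.
Proof.
case: s => [|x0 s] s_uniq sA; first by rewrite II0; apply: card_ge0.
set t := x0 :: s in s_uniq sA *.
have inj : {in `I_(size t) &, injective (nth x0 t)}.
  by move=> i j; rewrite !inE => it jt /eqP; rewrite nth_uniq// => /eqP.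
rewrite -(card_le_eql (inj_card_eq inj)); apply: subset_card_le.
by move=> _ [i it <-]; apply/sA/mem_nth.
Qed.

Local Open Scope nat_scope.

(* Gadget i excludes that both poles b get the colours [hub i b]. *)
Definition hub (i : nat) (b : bool) : nat := if b then i %/ 3 else 3 + i %% 3.

Definition pole_list (b : bool) : seq nat := if b then iota 0 3 else iota 3 3.

(** Index [k] is place [k %% 3] of gadget [k %/ 3]. Adjacent ends of two gadgets share 8 and 9;
    their union reaches five colours because the hub colours change. *)
Definition spine_list (k : nat) : seq nat :=
  [:: hub (k %/ 3) true, hub (k %/ 3) false
    & if k %% 3 == 1 then [:: 6; 7] else [:: 8; 9]].

(** Apices with residue 2 lie between consecutive gadgets; 6 and 7 keep their unions with the
    adjacent spine lists, which contain 8 and 9, large enough. *)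
Definition apex_list (b : bool) (k : nat) : seq nat :=
  [:: hub (k %/ 3) b; if k %% 3 == 0 then 7 else 6;
      if k %% 3 == 2 then 7 else if b then 8 else 9].

(** Nine gadgets of three spine vertices give 27 spine vertices, hence 26 spine edges. *)
Definition fan_list (v : fan 26) : seq nat :=
  match v with
  | inl (inl b) => pole_list b
  | inl (inr k) => spine_list k
  | inr (b, k) => apex_list b k
  end.

Lemma fan_list_size v : uniq (fan_list v) /\ 3 <= size (fan_list v).
Proof.
have check : all (fun k => [&& uniq (spine_list k), uniq (apex_list true k)
  & uniq (apex_list false k)]) (iota 0 27) by [].
have checkAt k : k < 27 -> [&& uniq (spine_list k), uniq (apex_list true k)
  & uniq (apex_list false k)].
  by move=> k27; apply: (allP check); rewrite mem_iota.
case: v => [[[]|k]|[b k]] //; split=> //.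
- by case/and3P: (checkAt k (ltn_ord k)).
- by rewrite /=; case: ifP.
- by case/and3P: (checkAt k (leqW (ltn_ord k))); case: b.
Qed.

Definition union_size (s t : seq nat) : nat := size (undup (s ++ t)).

Lemma fan_list_union u v :
  fan_arc u v -> 5 <= union_size (fan_list u) (fan_list v).
Proof.
pose bs := [:: true; false].
have poleSpine : all (fun b => all (fun k =>
    5 <= union_size (pole_list b) (spine_list k)) (iota 0 27)) bs by [].
have spineSpine : all (fun k =>
    5 <= union_size (spine_list k) (spine_list k.+1)) (iota 0 26) by [].
have apexAll : all (fun b => all (fun k =>
  [&& 5 <= union_size (pole_list b) (apex_list b k),
      5 <= union_size (spine_list k) (apex_list b k)
    & 5 <= union_size (spine_list k.+1) (apex_list b k)]) (iota 0 26)) bs by [].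
have bsP b : b \in bs by case: b.
have apexP b (k : 'I_26) : [/\ 5 <= union_size (pole_list b) (apex_list b k),
      5 <= union_size (spine_list k) (apex_list b k)
    & 5 <= union_size (spine_list k.+1) (apex_list b k)].
  by apply/and3P/(allP (allP apexAll _ (bsP b))); rewrite mem_iota /=.
case/fan_arcP => [b k|k l lk|b k|b k l lk|b k l lk] /=; rewrite ?lk.
- by apply: (allP (allP poleSpine _ (bsP b))); rewrite mem_iota ltn_ord.
- apply: (allP spineSpine); rewrite mem_iota /=.
  by rewrite -ltnS -lk ltn_ord.
- by case: (apexP b k).
- by case: (apexP b k).
- by case: (apexP b k).
Qed.

Lemma fan_list_assignment :
  list_assignment 3 5 (fun v => [set` fan_list v]).
Proof.
split=> [v | u v].
  have [v_uniq v3] := fan_list_size v.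
  by apply: card_le_trans (card_le_uniq v_uniq _) => //; rewrite card_le_II.
suff arc x y : fan_arc x y -> `I_5 #<= [set` fan_list x] `|` [set` fan_list y].
  by case/orP=> /arc //; rewrite setUC.
move=> xy; have xy_uniq := undup_uniq (fan_list x ++ fan_list y).
apply: card_le_trans (card_le_uniq xy_uniq _).
  by rewrite card_le_II; apply: fan_list_union.
by move=> c; rewrite mem_undup mem_cat => /orP[]; [left|right].
Qed.

(** * Impossibility of a colouring *)

Lemma gadget_uncolorable (h : bool -> nat) (z0 z1 z2 : nat)
    (w0 w1 : bool -> nat) :
  z0 \in [:: h true; h false; 8; 9] -> z1 \in [:: h true; h false; 6; 7] ->
  z2 \in [:: h true; h false; 8; 9] ->
  (forall b, w0 b \in [:: h b; 7; if b then 8 else 9]) ->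
  (forall b, w1 b \in [:: h b; 6; if b then 8 else 9]) ->
  (forall b, [/\ z0 <> h b, z1 <> h b, z2 <> h b, w0 b <> h b & w1 b <> h b]) ->
  (forall b, [/\ w0 b <> z0, w0 b <> z1, w1 b <> z1 & w1 b <> z2]) -> False.
Proof.
move=> Z0 Z1 Z2 W0 W1 H W.
have [z0t z1t z2t _ _] := H true; have [z0f z1f z2f _ _] := H false.
have last3 (x y t u : nat) : u \in [:: x; y; t] -> u <> x -> u <> y -> u = t.
  by rewrite !inE => /or3P[]/eqP.
have last4 (x x' y t u : nat) :
    u \in [:: x; x'; y; t] -> u <> x -> u <> x' -> u <> y -> u = t.
  by rewrite !inE => /or4P[]/eqP.
have w0E b : z1 = 7 -> w0 b = if b then 8 else 9.
  move=> z17; have [_ _ _ w0h _] := H b; have [_ w0z1 _ _] := W b.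
  by apply: last3 (W0 b) w0h _; rewrite -z17.
have w1E b : z1 <> 7 -> w1 b = if b then 8 else 9.
  move=> /eqP z17; have [_ _ _ _ w1h] := H b; have [_ _ w1z1 _] := W b.
  apply: last3 (W1 b) w1h _ => w16; apply: w1z1; rewrite w16.
  by move: Z1; rewrite !inE => /or4P[]/eqP // z17'; rewrite z17' in z17.
(* If [z1] is 7, the apices [w0] are forced to 8 and 9 and leave nothing for [z0]; otherwise [z1] is
   6, and [w1] does the same to [z2]. *)
have [z17|/eqP z17] := eqVneq z1 7.
- have [w0t _ _ _] := W true; have [w0f _ _ _] := W false.
  rewrite !w0E // in w0t w0f.
  by apply: w0f; rewrite (last4 _ _ _ _ _ Z0) // => /esym.
- have [_ _ _ w1t] := W true; have [_ _ _ w1f] := W false.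
  rewrite !w1E // in w1t w1f.
  by apply: w1f; rewrite (last4 _ _ _ _ _ Z2) // => /esym.
Qed.

Lemma fan_not_choosable : ~ choosable 3 5 (fan 26).
Proof.
move=> /(_ nat _ fan_list_assignment)[c [cL c_proper]].
have arcN u v : fan_arc u v -> c u <> c v.
  by move=> uv; apply: c_proper; rewrite /adj /= /fan_adj /= uv.
have [i [i9 hubE]] : exists i, i < 9 /\ forall b, hub i b = c (pole 26 b).
  (* This inverts [hub]: quotient and remainder by 3 encode the colours of the two poles, the second
     shifted by 3. *)
  exists (3 * c (pole 26 true) + (c (pole 26 false) - 3)).
  have x_lt : c (pole 26 true) < 3.
    by have := cL (pole 26 true); rewrite /= !inE => /or3P[]/eqP->.
  have y_in : 3 <= c (pole 26 false) < 6.
    by have := cL (pole 26 false); rewrite /= !inE => /or3P[]/eqP->.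
  split; first lia.
  have hubE x y b : x < 3 -> 3 <= y < 6 ->
      hub (3 * x + (y - 3)) b = if b then x else y.
    by case: x y => [|[|[|x]]] // [|[|[|[|[|[|y]]]]]] //; case: b.
  by case; rewrite hubE.
have j1 : (3 * i).+1 < 26 by move: i9; clear; lia.
have j0 : 3 * i < 26 := ltnW j1.
pose z k : fan 26 := spine (inord k : 'I_26.+1).
pose w b k : fan 26 := apex b (inord k : 'I_25.+1).
have zL k : k < 27 -> c (z k) \in spine_list k.
  by move=> k27; have := cL (z k); rewrite /= inordK.
have wL b k : k < 26 -> c (w b k) \in apex_list b k.
  by move=> k27; have := cL (w b k); rewrite /= inordK.
(* This holds for every [k], since any value of [inord] gives a spine vertex, adjacent to both
   poles. *)
have zH b k : c (z k) <> hub i b.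
  by rewrite hubE => /esym; apply: arcN.
have wH b k : c (w b k) <> hub i b.
  by rewrite hubE => /esym; apply: arcN; rewrite /= eqxx.
have wzL b k : k < 26 -> c (w b k) <> c (z k).
  by move=> k26 /esym; apply: arcN; rewrite /= !inordK ?eqxx // ltnW.
have wzR b k : k < 26 -> c (w b k) <> c (z k.+1).
  by move=> k26 /esym; apply: arcN; rewrite /= !inordK ?eqxx ?orbT.
have d0 : 3 * i %/ 3 = i by lia.
have d1 : (3 * i).+1 %/ 3 = i by lia.
have d2 : (3 * i).+2 %/ 3 = i by lia.
have m0 : 3 * i %% 3 = 0 by lia.
have m1 : (3 * i).+1 %% 3 = 1 by lia.
have m2 : (3 * i).+2 %% 3 = 2 by lia.
apply: (@gadget_uncolorable (hub i) (c (z (3 * i))) (c (z (3 * i).+1))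
  (c (z (3 * i).+2)) (fun b => c (w b (3 * i))) (fun b => c (w b (3 * i).+1))).
- by have := zL _ (leqW j0); rewrite /spine_list d0 m0.
- by have := zL _ (leqW j1); rewrite /spine_list d1 m1.
- by have := zL (3 * i).+2 j1; rewrite /spine_list d2 m2.
- by move=> b; have := wL b _ j0; rewrite /apex_list d0 m0.
- by move=> b; have := wL b _ j1; rewrite /apex_list d1 m1.
- by move=> b; split; [exact: zH|exact: zH|exact: zH|exact: wH|exact: wH].
- by move=> b; split; [exact: wzL|exact: wzR|exact: wzL|exact: wzR].
Qed.

Theorem proposition5 (R : realType) :
  exists G : sgraph, planar R G /\ ~ choosable 3 5 G.
Proof.
exists (fan 26); split; [exact: planar_fan | exact: fan_not_choosable].
Qed.
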